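(* Let $I\subset K[x,y,z]$ be a monomial ideal, $d\ge 1$, and let $T = T_d(I)$ be a balanced triangular region. The following statements hold. (i) Let $\tau$ and $\tau'$ be two lozenge tilings of $T$. Then their perfect matching signs are the same if and only if their lattice path signs are the same, that is, $$\operatorname{msgn}(\tau)\cdot \operatorname{lpsgn}(\tau) = \operatorname{msgn}(\tau')\cdot\operatorname{lpsgn}(\tau').$$ (ii) In particular, $|\det Z(T)| = |\det N(T)|$.
   Context: For $d\ge 1$, $\mathcal{T}_d$ is the equilateral triangle of side length $d$ subdivided into equilateral unit triangles. Its downward-pointing unit triangles are labelled bijectively by the monomials of degree $d-2$ in $x,y,z$, and its upward-pointing unit triangles by the monomials of degree $d-1$, with $x^{d-1}$ at the top, $y^{d-1}$ at the bottom-left, $z^{d-1}$ at the bottom-right; a downward-pointing triangle with label $n$ and an upward-pointing triangle with label $m$ share an edge if and only if $m\in\{xn,yn,zn\}$. For a monomial ideal $I$, $T=T_d(I)$ is the set of unit triangles whose label is not in $I$. Let $D$ (resp. $U$) be the set of monomials of degree $d-2$ (resp. $d-1$) not in $I$, i.e. the labels of the downward- (resp. upward-) pointing triangles of $T$. $T$ is balanced if $|D|=|U|$. A lozenge is a union of two unit triangles sharing an edge; a lozenge tiling $\tau$ of $T$ is a partition of $T$ into lozenges, equivalently a bijection $\pi:D\to U$ with $\pi(n)\in\{xn,yn,zn\}$ for all $n\in D$. Monomials of the same degree are ordered by the (graded) reverse-lexicographic order: $x^ay^bz^c>x^py^qz^r$ if the last non-zero entry of $(a-p,b-q,c-r)$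 is negative. Bi-adjacency matrix: $Z(T)$ is the $|D|\times|U|$ zero-one matrix with rows indexed by $D$ and columns by $U$, both in reverse-lexicographic order, whose $(n,m)$ entry is $1$ iff $m\in\{xn,yn,zn\}$. The perfect matching sign $\operatorname{msgn}(\tau)$ is the signature of the permutation of $\{1,\dots,|U|\}$ given by $\pi$ via these orderings. Lattice path matrix: let $A_1,\dots,A_m$ be the monomials $u\in U$ not divisible by $z$, listed from smallest to largest, and let $E_1,\dots,E_n$ be the monomials $u$ of degree $d-1$ with $z\mid u$, $u/z\notin I$ and $u\in I$, listed from smallest to largest (these correspond to the unit edges parallel to the upper-left side of $\mathcal{T}_d$ that belong to an upward-pointing triangle only, respectively a downward-pointing triangle only, of $T$; one has $m=n$ iff $T$ is balanced). Identify the monomial $x^ay^bz^{d-1-a-b}$ with the point $(d-1-b,a)\in\mathbb{Z}^2$. A lattice path in $\mathbb{Z}^2$ is a finite sequence of points with steps $(1,0)$ or $(0,-1)$. $N(T)$ is the $m\times n$ matrix whose $(i,j)$ entry is the number of lattice paths in $\mathbb{Z}^2$ from $A_i$ to $E_j$; thus for $A_i=x^sy^{d-1-s}$ and $E_j=x^py^{q}z^e$ the entry is $\binom{e}{s-p}$ (zero if $s<p$ or $s-p>e$). Determinants of $0\times 0$ matrices are $1$. Lattice path sign: a tiling $\pi$ determines a family of non-intersecting lattice paths by drawing, for each $n\in D$ with $\pi(n)=xn$, a step from $xn$ to $zn$, and for each $n\in D$ with $\pi(n)=yn$, a step from $yn$ to $zn$ (no step if $\pi(n)=zn$). The path starting at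 $A_i$ ends at some $E_{\lambda(i)}$, which defines a permutation $\lambda\in\mathfrak{S}_m$, and $\operatorname{lpsgn}(\tau)=\operatorname{sgn}(\lambda)$. *)

(* Defs.v *)
From mathcomp Require Import all_boot all_order all_algebra all_fingroup.
From mathcomp Require Import finmap.
From mathcomp Require Import boolp classical_sets cardinality.
From mathcomp Require Import mpoly.

Set Implicit Arguments.
Unset Strict Implicit.
Unset Printing Implicit Defensive.

Import GRing.Theory Num.Theory.
Local Open Scope ring_scope.

(* The variables x, y, z of K[x,y,z] = {mpoly K[3]} are those of index
   ix, iy, iz; a monomial x^a y^b z^c is the exponent vector in 'X_{1..3}. *)
Definition ix : 'I_3 := @Ordinal 3 0 isT.
Definition iy : 'I_3 := @Ordinal 3 1 isT.
Definition iz : 'I_3 := @Ordinal 3 2 isT.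

(* I is the ideal generated by some set S of monomials. *)
Definition monomial_ideal (K : fieldType) (I : set {mpoly K[3]}) : Prop :=
  exists S : set 'X_{1..3}, forall p : {mpoly K[3]},
    I p <-> exists s : seq ({mpoly K[3]} * 'X_{1..3}),
              (forall t, t \in s -> S t.2) /\
              p = \sum_(t <- s) t.1 * 'X_[t.2].

Definition in_ideal (K : fieldType) (I : set {mpoly K[3]}) (m : 'X_{1..3}) :
  bool := `[< I 'X_[m] >].

(* Used only to compare monomials of the same degree. *)
Definition revlex_gt (m m' : 'X_{1..3}) : bool :=
  [exists i : 'I_3, (m i < m' i)%N &&
     [forall j : 'I_3, (i < j)%N ==> (m j == m' j)]].

Definition revlex_le (m m' : 'X_{1..3}) : bool :=
  (m == m') || revlex_gt m' m.

(* The unit triangles of T_d are represented by their labels; the degree of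
   the label (d - 2 or d - 1) tells the orientation of the triangle. *)
Notation label d := 'X_{1..3 < d}.

Definition adjacent (n m : 'X_{1..3}) : bool :=
  [exists i : 'I_3, m == (n + U_(i))%MM].

Definition downward d (t : label d) : bool := (mdeg t).+2 == d.
Definition upward d (t : label d) : bool := (mdeg t).+1 == d.

(* From smallest to largest. *)
Definition revlex_enum d (A : {set label d}) : #|A|.-tuple (label d) :=
  [tuple of sort (fun t u : label d => revlex_le t u) (enum_tuple A)].

Section Region.
Variables (K : fieldType) (I : set {mpoly K[3]}) (d : nat).

Definition region : {set label d} :=
  [set t : label d | (downward t || upward t) && ~~ in_ideal I t].
Definition downs : {set label d} := [set t in region | downward t].
Definition ups : {set label d} := [set t in region | upward t].

Definition balanced : Prop := #|downs| = #|ups|.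

Definition lozenge (L : {set label d}) : bool :=
  [exists n : label d, exists m : label d,
     [&& downward n, upward m, adjacent n m & L == [set n; m]]].

Definition lozenge_tiling (tau : {set {set label d}}) : bool :=
  finset.partition tau region && [forall L in tau, lozenge L].

Definition Zmx : 'M[int]_(#|downs|, #|ups|) :=
  \matrix_(i, j)
    (adjacent (tnth (revlex_enum downs) i) (tnth (revlex_enum ups) j))%:R.

Definition path_starts : {set label d} :=
  [set u in ups | u iz == 0%N].
Definition path_ends : {set label d} :=
  [set u : label d | [&& upward u, (0 < u iz)%N,
     ~~ in_ideal I (u - U_(iz))%MM & in_ideal I u]].

End Region.

Definition lattice_point d (m : label d) : int * int :=
  ((d.-1)%:Z - (m iy)%:Z, (m ix)%:Z).

Definition lattice_step (p q : int * int) : bool :=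
  (q == (p.1 + 1, p.2)) || (q == (p.1, p.2 - 1)).

(* The sequence of points of the path is p :: s. *)
Definition lattice_path (p q : int * int) (s : seq (int * int)) : bool :=
  path lattice_step p s && (last p s == q).

(* There are finitely many lattice paths from p to q, since each of them has
   (q.1 - q.2) - (p.1 - p.2) steps. *)
Definition num_lattice_paths (p q : int * int) : nat :=
  #|` fset_set [set s | lattice_path p q s]%classic |%fset.

(* The permutation s such that R relates the i-th row index to the s(i)-th
   column index, for all i (unique when R is the graph of a bijection; the
   default 1 is not used for a lozenge tiling of a balanced region). *)
Definition perm_of_rel m n (e : m = n) (R : 'I_m -> 'I_n -> bool) : 'S_m :=
  odflt 1%g [pick s : 'S_m | [forall i, R i (cast_ord e (s i))]].

Section Signs.
Variables (K : fieldType) (I : set {mpoly K[3]}) (d : nat).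

Definition Nmx : 'M[int]_(#|path_starts I d|, #|path_ends I d|) :=
  \matrix_(i, j)
    (num_lattice_paths
       (lattice_point (tnth (revlex_enum (path_starts I d)) i))
       (lattice_point (tnth (revlex_enum (path_ends I d)) j)))%:R.

Definition msgn (bal : balanced I d) (tau : {set {set label d}}) : int :=
  (-1) ^+ perm_of_rel bal (fun i j =>
    [set tnth (revlex_enum (downs I d)) i; tnth (revlex_enum (ups I d)) j]
      \in tau).

(* For n in D covered by the lozenge {n, xn} or {n, yn} of tau, a step from
   that upward neighbour of n to zn. *)
Definition tiling_step (tau : {set {set label d}}) : rel (label d) :=
  fun u v => [exists n in downs I d, exists i : 'I_3,
    [&& i != iz, bmnm u == (n + U_(i))%MM, [set n; u] \in tau
      & bmnm v == (n + U_(iz))%MM]].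

Definition lpsgn (e : #|path_starts I d| = #|path_ends I d|)
    (tau : {set {set label d}}) : int :=
  (-1) ^+ perm_of_rel e (fun i j =>
    connect (tiling_step tau) (tnth (revlex_enum (path_starts I d)) i)
                              (tnth (revlex_enum (path_ends I d)) j)).


End Signs.

Lemma in_idealMX (K : fieldType) (I : set {mpoly K[3]}) (m : 'X_{1..3})
    (i : 'I_3) :
  monomial_ideal I -> in_ideal I m -> in_ideal I (m + U_(i))%MM.
Proof.
move=> [S hS] /asboolP/hS [s [sS es]]; apply/asboolP/hS.
exists [seq (t.1 * 'X_i, t.2) | t <- s]; split.
  by move=> t /mapP[u us ->] /=; exact: sS.
rewrite big_map mpolyXD es mulr_suml; apply: eq_bigr => t _ /=.
by rewrite mulrAC.
Qed.

Lemma card_path_ends (K : fieldType) (I : set {mpoly K[3]}) (d : nat) :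
  monomial_ideal I -> balanced I d -> #|path_starts I d| = #|path_ends I d|.
Proof.
move=> hI bal.
have subK (u : 'X_{1..3}) : (0 < u iz)%N -> (u - U_(iz) + U_(iz))%MM = u.
  by move=> u_gt0; rewrite submK // lep1mP -lt0n.
pose W : {set label d} := [set u : label d | [&& upward u, (0 < u iz)%N &
  ~~ in_ideal I (u - U_(iz))%MM]].
have lt_div (u : label d) : (mdeg (u - U_(iz))%MM < d)%N.
  exact: leq_ltn_trans (mdegB _ _) (bmdeg u).
pose g (u : label d) : label d := BMultinom (lt_div u).
have imW : g @: W = downs I d.
  apply/setP => n; apply/imsetP/idP => [[u]|].
    rewrite inE => /and3P[/eqP up_u u_gt0 uI] ->.
    have dn : downward (g u).
      rewrite /downward -{2}up_u -[X in _ == (mdeg X).+1](subK u u_gt0) /=.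
      by rewrite mdegD mdeg1 addn1.
    by rewrite !inE dn /= uI.
  rewrite !inE => /andP[/andP[_ nI] dn].
  have lt_nz : (mdeg (n + U_(iz))%MM < d)%N.
    by rewrite mdegD mdeg1 addn1; exact: eq_leq (eqP dn).
  have nzK : (n + U_(iz) - U_(iz))%MM = n by exact: addmK.
  exists (BMultinom lt_nz); last by apply: val_inj => /=.
  rewrite inE /upward /= mdegD mdeg1 addn1 nzK nI (eqP dn) eqxx /=.
  by rewrite mnmDE mnm1E eqxx addn1.
have g_inj : {in W &, injective g}.
  move=> u v; rewrite !inE => /and3P[_ u_gt0 _] /and3P[_ v_gt0 _].
  move=> /(congr1 val) /= e; apply: val_inj => /=.
  by rewrite -(subK u u_gt0) e subK.
have cardW : #|W| = #|ups I d| by rewrite -bal -imW card_in_imset.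
have defE : path_ends I d = W :\: ups I d.
  apply/setP => u; rewrite !inE.
  by case: (upward u); case: (0 < _)%N; case: (in_ideal I u);
     rewrite ?(orbT, andbF, andbT).
have defA : path_starts I d = ups I d :\: W.
  apply/setP => u; rewrite !inE.
  case up_u: (upward u); rewrite ?andbF // ?orbT ?andbT.
  case: (posnP (u iz)) => [u0|u_gt0].
    by rewrite andbT.
  rewrite andbF; apply/esym/negP => /andP[/negPn uI uIN].
  by case/negP: uIN; rewrite -(subK u u_gt0); exact: in_idealMX.
by rewrite defA defE !cardsD cardW finset.setIC.
Qed.

(* Main.v *)
(* Multiplication by z embeds D into the monomials of degree d - 1, and then
   A is the complement of zD in U and E that of U in zD.  So Z(T) is a matrix
   from zD to U in which the row w has a 1 at w (if w is in U) and at xw/z and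
   yw/z.  Border Z(T) by the columns E and the rows A: both indices now range
   over the union of zD and U.  All entries off the diagonal of this union
   lower the exponent of z, so the determinant of the bordered matrix is a sign
   that does not depend on which of the steps to xw/z and yw/z are kept.  Its
   inverse counts the paths, with the sign given by the exponent of z, and the
   minor of this inverse complementary to Z(T) is, up to a constant sign, the
   determinant of the matrix of paths from A to E.

   With all steps of T, these are the paths inside T; the matrix N(T) of all
   lattice paths is their matrix times the unitriangular matrix of paths from E
   to E, because a path that enters I does so at a point of E.  With the steps
   of a tiling only, the two determinants are msgn and lpsgn. *)

Require Import Defs.
From mathcomp Require Import all_boot all_order all_algebra all_fingroup.
From mathcomp Require Import finmap.
From mathcomp Require Import boolp classical_sets cardinality.
From mathcomp Require Import mpoly.
From mathcomp Require Import ring.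
Local Open Scope ring_scope.
Set Implicit Arguments.
Unset Strict Implicit.
Unset Printing Implicit Defensive.
Import GRing.Theory Num.Theory.

(** * Changes of a matrix that preserve its determinant *)

(** As [\det B] is nonzero, some permutation meets only nonzero entries of B, so f and g have equal
    sums. A nonzero term of [\det A] has f <= g along it, strictly at a changed entry, against this
    equality. Terms through a changed entry thus vanish for A, and for B because f < g at that
    entry. *)
Lemma det_graded (R : idomainType) (n : nat) (A B : 'M[R]_n)
    (f g : 'I_n -> nat) :
    \det B != 0 ->
    (forall i j, B i j != 0 -> f i = g j) ->
    (forall i j, A i j != B i j -> (f i < g j)%N) ->
  \det A = \det B.
Proof.
move=> detB fgB fgA.
have [s0 /forallP Bs0] : exists s : 'S_n, [forall i, B i (s i) != 0].
  apply/existsP; apply: contraNT detB => /existsPn noS.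
  rewrite /determinant big1 // => s _.
  have /forallPn[i /negPn/eqP Bi0] := noS s.
  by rewrite (bigD1 i) //= Bi0 mul0r mulr0.
have sum_fg (s : 'S_n) : (\sum_i f i = \sum_i g (s i))%N.
  rewrite -(reindex_inj (@perm_inj _ s) (P := xpredT) (F := g)) /=.
  rewrite [RHS](reindex_inj (@perm_inj _ s0)) /=.
  by apply: eq_bigr => i _; rewrite -(fgB _ _ (Bs0 i)).
rewrite /determinant; apply: eq_bigr => s _; congr (_ * _).
case: (boolP [forall i, A i (s i) == B i (s i)]) => [/forallP eqAB|].
  by apply: eq_bigr => i _; apply/eqP.
case/forallPn => i0 neqAB.
have ltfg := fgA _ _ neqAB.
have {neqAB} A0 : \prod_i A i (s i) == 0.
  apply/negPn/negP => nz; have := sum_fg s.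
  have lefg i : (f i <= g (s i))%N.
    case: (eqVneq (A i (s i)) (B i (s i))) => [eqAB|/fgA/ltnW //].
    rewrite (fgB i (s i)) // -eqAB.
    move: nz; rewrite prodf_seq_neq0 => /allP/(_ i).
    by rewrite mem_index_enum => /(_ isT).
  apply/eqP; rewrite neq_ltn; apply/orP; left.
  rewrite (bigD1 i0) //= [X in (_ < X)%N](bigD1 i0) //=.
  by rewrite -addSn leq_add // leq_sum.
rewrite (eqP A0); apply/esym/eqP; apply/prodf_eq0; exists i0 => //.
by apply: contraLR ltfg => /fgB ->; rewrite ltnn.
Qed.

(** * Enumerated labels, permutation matrices and reachability *)

Lemma tnth_revlex_enum_inj d (A : {set label d}) :
  injective (tnth (revlex_enum A)).
Proof.
apply/tuple_uniqP; rewrite sort_uniq; exact: enum_uniq.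
Qed.

Lemma big_revlex_enum (R : Type) (idx : R) (op : Monoid.com_law idx) d
    (A : {set label d}) (F : label d -> R) :
  \big[op/idx]_i F (tnth (revlex_enum A) i) = \big[op/idx]_(u in A) F u.
Proof.
rewrite -(big_tuple _ _ (revlex_enum A) xpredT F) -[RHS]big_enum /=.
by apply: perm_big; rewrite perm_sort.
Qed.

Lemma mem_revlex_enum d (A : {set label d}) i : tnth (revlex_enum A) i \in A.
Proof. by have := mem_tnth i (revlex_enum A); rewrite mem_sort mem_enum. Qed.

Lemma revlex_enumP d (A : {set label d}) u :
  u \in A -> exists i, u = tnth (revlex_enum A) i.
Proof. by move=> uA; apply/tnthP; rewrite mem_sort mem_enum. Qed.

Lemma sum_label_eq d (A : {set label d}) (w : 'X_{1..3}) (lt_w : (mdeg w < d)%N)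
    (F : 'X_{1..3} -> int) :
  \sum_(u in A) (bmnm u == w)%:R * F u = (BMultinom lt_w \in A)%:R * F w.
Proof.
rewrite big_mkcond (bigD1 (BMultinom lt_w)) //= big1 ?addr0.
  by rewrite eqxx; case: ifP; rewrite ?mul1r ?mul0r.
move=> u /negPf neq_u; case: ifP => // _.
by rewrite -[bmnm u == _]/(u == BMultinom lt_w) neq_u mul0r.
Qed.

(** The hypothesis leaves [s] as the only candidate for [pick], so the default value 1 is not
    taken. *)
Lemma det_perm_of_rel m n (e : m = n) (R : 'I_m -> 'I_n -> bool)
    (s : 'S_m) :
  (forall i j, R i (cast_ord e j) = (j == s i)) ->
  \det (\matrix_(i, j) (R i (cast_ord e j))%:R) =
    (-1) ^+ perm_of_rel e R :> int.
Proof.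
move=> Rs; have -> : perm_of_rel e R = s.
  rewrite /perm_of_rel; case: pickP => /= [t /forallP Rt|/(_ s)/forallP[]].
    by apply/permP => i; have := Rt i; rewrite Rs => /eqP.
  by move=> i; rewrite Rs.
rewrite -det_perm; congr determinant; apply/matrixP => i j.
by rewrite !mxE Rs eq_sym.
Qed.

(** A row without a 1 is zero, and two rows with their 1 in the same column are equal; either would
    make the determinant vanish. *)
Lemma functional_det_neq0 m (R : 'I_m -> 'I_m -> bool) :
    (forall i j k, R i j -> R i k -> j = k) ->
    \det (\matrix_(i, j) (R i j)%:R : 'M[int]_m) != 0 ->
  exists s : 'S_m, forall i j, R i j = (j == s i).
Proof.
set M := \matrix_(i, j) _ => funR detM.
have exR i : exists j, R i j.
  apply/existsP; apply: contraNT detM => /existsPn noR.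
  rewrite (expand_det_row M i) big1 // => j _.
  by rewrite mxE (negPf (noR j)) mul0r.
pose f i := xchoose (exR i).
have Rf i j : R i j = (j == f i).
  apply/idP/eqP => [Rij|->]; last exact: (xchooseP (exR i)).
  exact: funR Rij (xchooseP (exR i)).
have f_inj : injective f.
  move=> i1 i2 eqf; apply/eqP; apply: contraNT detM => neq_i.
  rewrite (determinant_alternate neq_i) // => j.
  by rewrite !mxE !Rf eqf.
by exists (perm f_inj) => i j; rewrite permE.
Qed.

Lemma connect_last (T : finType) (e : rel T) x y :
  connect e x y -> x = y \/ exists2 z, connect e x z & e z y.
Proof.
case/connectP => p; elim/last_ind: p y => [|p z _] y; first by left.
rewrite rcons_path last_rcons => /andP[e_p e_z] ->; right.
by exists (last x p) => //; apply/connectP; exists p.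
Qed.

Lemma connect_functional (T : finType) (e : rel T) x y y' :
    (forall u v v', e u v -> e u v' -> v = v') ->
    connect e x y -> connect e x y' ->
    (forall v, ~~ e y v) -> (forall v, ~~ e y' v) ->
  y = y'.
Proof.
move=> e_fun /connectP[p + ->] /connectP[p' + ->].
elim: p p' x => [|z p IHp] [|z' p'] x //=.
- by move=> _ /andP[xz' _] /(_ z')/negP[].
- by move=> /andP[xz _] _ _ /(_ z)/negP[].
move=> /andP[xz e_p] /andP[xz' e_p'].
by rewrite -(e_fun _ _ _ xz xz') in e_p' *; apply: IHp.
Qed.

Lemma big_revlex_enum_cast (R : Type) (idx : R) (op : Monoid.com_law idx) d
    (A : {set label d}) n (e : n = #|A|) (F : label d -> R) :
  \big[op/idx]_j F (tnth (revlex_enum A) (cast_ord e j)) =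
    \big[op/idx]_(u in A) F u.
Proof.
subst n; rewrite -big_revlex_enum.
by apply: eq_bigr => j _; rewrite cast_ord_id.
Qed.

(** * Counting paths by the exponent of z *)

Lemma mnmDUz (n : 'X_{1..3}) : (n + U_(iz))%MM iz = (n iz).+1.
Proof. by rewrite mnmDE mnm1E eqxx addn1. Qed.

Lemma mnmDUNz (n : 'X_{1..3}) l : l != iz -> (n + U_(l))%MM iz = n iz.
Proof. by move=> /negPf l_z; rewrite mnmDE mnm1E l_z addn0. Qed.

Lemma mdegDU (n : 'X_{1..3}) l : mdeg (n + U_(l)) = (mdeg n).+1.
Proof. by rewrite mdegD mdeg1 addn1. Qed.

Lemma mnmDU_eq (n : 'X_{1..3}) l l' :
  ((n + U_(l))%MM == (n + U_(l'))%MM) = (l == l').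
Proof.
rewrite eqm_add2l; apply/eqP/eqP => [/mnmP/(_ l)|-> //].
by rewrite !mnm1E eqxx; case: eqVneq.
Qed.

Lemma mnm_subUzK (v : 'X_{1..3}) :
  (0 < v iz)%N -> (v - U_(iz) + U_(iz))%MM = v.
Proof. by move=> v_gt0; rewrite submK // lep1mP -lt0n. Qed.

(** The induction follows the steps backwards: zn is entered from xn or yn only, whose exponent of z
    is one less. *)
Lemma mnm_z_ind (P : 'X_{1..3} -> Prop) :
    (forall v : 'X_{1..3}, v iz = 0%N -> P v) ->
    (forall n : 'X_{1..3}, (forall l, l != iz -> P (n + U_(l))%MM) ->
       P (n + U_(iz))%MM) ->
  forall v, P v.
Proof.
move=> P0 PS v; have [k] := ubnP (v iz); elim: k v => // k IHk v lt_v_k.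
have [/P0 //|v_gt0] := posnP (v iz).
rewrite -(mnm_subUzK v_gt0); apply: PS => l l_z; apply: IHk.
by rewrite mnmDUNz // mnmBE mnm1E eqxx subn1 prednK.
Qed.

(* A path reaches [n + U_(iz)] from [n + U_(l)], for l = x or y; [w n l] tells
   whether this step is allowed.  The number [k] bounds the exponent of z, which
   every step increases by 1. *)
Fixpoint paths_rec (w : 'X_{1..3} -> 'I_3 -> bool) (a : 'X_{1..3}) (k : nat)
    (v : 'X_{1..3}) : int :=
  (v == a)%:R +
  if k is k'.+1 then
    \sum_(l | l != iz) (w (v - U_(iz))%MM l)%:R *
       paths_rec w a k' (v - U_(iz) + U_(l))%MM
  else 0.

(** The bound [v iz] is exact: it reaches 0 when z no longer divides the monomial, and then no step
    can end there. *)
Definition paths w (a v : 'X_{1..3}) : int := paths_rec w a (v iz) v.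

Lemma paths_z0 w (a v : 'X_{1..3}) : v iz = 0%N -> paths w a v = (v == a)%:R.
Proof. by rewrite /paths => -> /=; rewrite addr0. Qed.

Lemma paths_zS w (a n : 'X_{1..3}) :
  paths w a (n + U_(iz)) = ((n + U_(iz))%MM == a)%:R +
    \sum_(l | l != iz) (w n l)%:R * paths w a (n + U_(l)).
Proof.
rewrite /paths mnmDUz /= addmK; congr (_ + _); apply: eq_bigr => l l_z.
by rewrite mnmDUNz.
Qed.

Definition any_step (n : 'X_{1..3}) (l : 'I_3) : bool := true.

(** * Lattice paths in the integer plane *)

(** Built from the end, the last step entering [q] from the left or from above, so that the
    recursion matches that of [paths]. *)
Fixpoint lattice_paths_of_size k (p q : int * int) : seq (seq (int * int)) :=
  if k is k'.+1 then
    [seq rcons s q | s <- lattice_paths_of_size k' p (q.1 - 1, q.2) ++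
                          lattice_paths_of_size k' p (q.1, q.2 + 1)]
  else if p == q then [:: [::]] else [::].

Lemma lattice_path_rcons p q s r :
  lattice_path p q (rcons s r) =
    (r == q) &&
    (lattice_path p (q.1 - 1, q.2) s || lattice_path p (q.1, q.2 + 1) s).
Proof.
rewrite /lattice_path rcons_path last_rcons andbC.
case: eqP => //= ->; rewrite -andb_orr; congr (_ && _).
case: (last p s) q => u1 u2 [q1 q2].
rewrite /lattice_step !xpair_eqE /=; congr (_ || _).
  by rewrite (eq_sym q2) eq_sym -subr_eq opprK.
by rewrite (eq_sym q1) (eq_sym q2) subr_eq.
Qed.

Lemma mem_lattice_paths_of_size k p q s :
  (s \in lattice_paths_of_size k p q) = lattice_path p q s && (size s == k).
Proof.
elim: k q s => [|k IHk] q s /=.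
  case: s => [|r s]; last by case: ifP => _; rewrite ?inE andbF.
  by rewrite /lattice_path /= andbT; case: ifP.
case/lastP: s => [|s r].
  by rewrite andbF; apply/negP => /mapP[[|? ?] _].
rewrite size_rcons eqSS lattice_path_rcons.
apply/mapP/andP => [[s' + /rcons_inj[-> ->]]|[]].
  by rewrite mem_cat !IHk -andb_orl => /andP[-> ->]; rewrite eqxx.
move=> /andP[/eqP -> s_path] s_k; exists s => //.
by rewrite mem_cat !IHk -andb_orl s_path.
Qed.

Lemma uniq_lattice_paths_of_size k p q : uniq (lattice_paths_of_size k p q).
Proof.
elim: k q => [|k IHk] q /=; first by case: ifP.
rewrite map_inj_uniq => [|s1 s2]; last by case/rcons_inj.
rewrite cat_uniq !IHk andbT; apply/hasPn => s.
rewrite !mem_lattice_paths_of_size => /andP[/andP[_ /eqP last_s] _].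
rewrite /lattice_path last_s xpair_eqE negb_and negb_and; apply/orP; left.
apply/orP; right; rewrite negb_and; apply/orP; left.
by rewrite -subr_eq0 opprB addrC subrK oner_neq0.
Qed.

Lemma size_lattice_path p q s :
  lattice_path p q s -> q.1 - q.2 = p.1 - p.2 + (size s)%:Z.
Proof.
elim/last_ind: s q => [|s r IHs] q.
  by move=> /andP[_ /eqP <-]; rewrite addr0.
rewrite lattice_path_rcons size_rcons -addn1 PoszD addrA => /andP[_].
by case/orP => /IHs <- /=; ring.
Qed.

(** The difference of the coordinates grows by 1 at each step, so all paths from [p] to [q] have the
    same size [k]. *)
Lemma num_lattice_paths_size k p q :
  q.1 - q.2 = p.1 - p.2 + k%:Z ->
  num_lattice_paths p q = size (lattice_paths_of_size k p q).
Proof.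
move=> pq_k; rewrite /num_lattice_paths.
have memL s : lattice_path p q s = (s \in lattice_paths_of_size k p q).
  rewrite mem_lattice_paths_of_size andb_idr // => /size_lattice_path.
  by rewrite pq_k => /addrI[->].
have -> : [set s | lattice_path p q s]%classic =
          [set` seq_fset tt (lattice_paths_of_size k p q)]%classic.
  by apply/seteqP; split => s; rewrite /mkset memL (seq_fsetE tt).
by rewrite set_fsetK size_seq_fset undup_id // uniq_lattice_paths_of_size.
Qed.

(** For labels of degree d - 1 the difference of the coordinates is the exponent of z, so a path
    from [a] to [v] has [v iz] steps and both counts satisfy the same recursion. *)
Lemma num_lattice_paths_paths d (a v : label d) :
    a iz = 0%N -> (mdeg a).+1 = d -> (mdeg v).+1 = d ->
  (num_lattice_paths (lattice_point a) (lattice_point v))%:R =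
    paths any_step a v.
Proof.
move=> a_z deg_a deg_v.
pose pt (u : 'X_{1..3}) : int * int := ((d.-1)%:Z - (u iy)%:Z, (u ix)%:Z).
have mdeg3 (u : 'X_{1..3}) : mdeg u = (u ix + u iy + u iz)%N.
  rewrite mdegE (bigD1 ix) //= (bigD1 iy) //= (bigD1 iz) //=.
  rewrite big1 ?addn0 ?addnA //.
  by case=> [[|[|[|]]]].
have level (u : 'X_{1..3}) : (mdeg u).+1 = d -> (pt u).1 - (pt u).2 = (u iz)%:Z.
  by rewrite mdeg3 /pt => <- /=; rewrite !PoszD; ring.
rewrite (@num_lattice_paths_size (bmnm v iz)); last first.
  by rewrite (level v deg_v) (level a deg_a) a_z add0r.
rewrite -[lattice_point a]/(pt a) -[lattice_point v]/(pt v).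
move: (bmnm v) deg_v.
apply: (@mnm_z_ind (fun v => _ -> _)) => [{}v v_z|n IHn] deg_v.
  rewrite v_z paths_z0 //= -[LHS]/((size (if _ then _ else _))%:R).
  have -> : (pt a == pt v) = (v == a).
    apply/eqP/eqP => [|-> //].
    rewrite /pt => -[+ eq_x] => /addrI/oppr_inj[eq_y].
    apply/mnmP => -[[|[|[|//]]] lt_i].
    - by rewrite (_ : Ordinal _ = ix) ?eq_x //; apply: val_inj.
    - by rewrite (_ : Ordinal _ = iy) ?eq_y //; apply: val_inj.
    - by rewrite (_ : Ordinal _ = iz) ?v_z ?a_z //; apply: val_inj.
  by case: eqP.
rewrite paths_zS mnmDUz /= size_map size_cat natrD.
have /negPf-> : (n + U_(iz))%MM != a.
  by apply: contra_eqN a_z => /eqP <-; rewrite mnmDUz.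
rewrite add0r (bigD1 ix) //= (bigD1 iy) //= big1 => [|[[|[|[|//]]]] //].
rewrite addr0 !mul1r -!IHn //; try by rewrite -deg_v !mdegDU.
set q := pt (n + U_(iz))%MM.
(* A step (1,0) trades a factor y for z, a step (0,-1) a factor x for z. *)
have <- : (q.1 - 1, q.2) = pt (n + U_(iy))%MM.
  by rewrite /q /pt !mnmDE !mnm1E /= !addn0 PoszD opprD addrA.
have <- : (q.1, q.2 + 1) = pt (n + U_(ix))%MM.
  by rewrite /q /pt !mnmDE !mnm1E /= !addn0 PoszD.
by rewrite !mnmDUNz // addrC.
Qed.

Implicit Types (w : 'X_{1..3} -> 'I_3 -> bool).

(** * The bordered matrix of a region *)

Section Region.
Variables (K : fieldType) (I : set {mpoly K[3]}) (d : nat).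
Hypotheses (hI : monomial_ideal I) (bal : balanced I d).

Notation D := (downs I d).
Notation U := (ups I d).
Notation A := (path_starts I d).
Notation E := (path_ends I d).

Let balAE : #|A| = #|E| := card_path_ends hI bal.
Let dn (i : 'I_#|D|) : label d := tnth (revlex_enum D) i.
Let up (j : 'I_#|D|) : label d := tnth (revlex_enum U) (cast_ord bal j).
Let st (i : 'I_#|A|) : label d := tnth (revlex_enum A) i.
Let en (j : 'I_#|A|) : label d := tnth (revlex_enum E) (cast_ord balAE j).

Lemma mem_downs (n : label d) :
  (n \in D) = ((mdeg n).+2 == d) && ~~ in_ideal I n.
Proof. by rewrite !inE /downward; case: (_.+2 == d); rewrite ?andbF ?andbT. Qed.

Lemma mem_ups (n : label d) :
  (n \in U) = ((mdeg n).+1 == d) && ~~ in_ideal I n.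
Proof.
by rewrite !inE /upward; case: (_.+1 == d); rewrite ?andbF ?andbT ?orbT.
Qed.

Lemma mem_path_starts (n : label d) :
  (n \in A) = [&& (mdeg n).+1 == d, ~~ in_ideal I n & n iz == 0%N].
Proof. by rewrite inE mem_ups andbA. Qed.

Lemma mem_path_ends_zS (n : 'X_{1..3}) lt_nd :
  (@BMultinom 3 d (n + U_(iz))%MM lt_nd \in E) =
    [&& (mdeg n).+2 == d, ~~ in_ideal I n & in_ideal I (n + U_(iz))%MM].
Proof. by rewrite inE /upward /= mdegDU mnmDUz addmK. Qed.

(** Besides the entry at zn, row n keeps only the steps allowed by [w]; one matrix thus serves both
    for Z(T) and for a single tiling. *)
Definition step_mx w : 'M[int]_#|D| :=
  \matrix_(i, j) ((bmnm (up j) == dn i + U_(iz))%MM%:R +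
    \sum_(l | l != iz)
       (w (bmnm (dn i)) l)%:R * (bmnm (up j) == dn i + U_(l))%MM%:R).

Definition ends_mx : 'M[int]_(#|D|, #|A|) :=
  \matrix_(i, k) (bmnm (en k) == dn i + U_(iz))%MM%:R.

Definition starts_mx : 'M[int]_(#|A|, #|D|) :=
  \matrix_(i, j) (bmnm (up j) == bmnm (st i))%:R.

Definition path_mx w : 'M[int]_#|A| :=
  \matrix_(i, j) paths w (st i) (en j).

Definition bordered_mx w : 'M[int]_(#|D| + #|A|) :=
  block_mx (step_mx w) ends_mx starts_mx 0.

(** The signs of the rows E of the inverse, pulled out of the complementary minor. *)
Definition ends_sign : int := \prod_(u in E) (-1) ^+ bmnm u iz.

Lemma dn_mem i : dn i \in D. Proof. exact: mem_revlex_enum. Qed.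
Lemma up_mem i : up i \in U. Proof. exact: mem_revlex_enum. Qed.
Lemma st_mem i : st i \in A. Proof. exact: mem_revlex_enum. Qed.
Lemma en_mem i : en i \in E. Proof. exact: mem_revlex_enum. Qed.

Lemma mdeg_dnDU_eq i l : (mdeg (dn i + U_(l))%MM).+1 = d.
Proof.
by have := dn_mem i; rewrite mem_downs mdegDU => /andP[/eqP e_d _]; exact: e_d.
Qed.

Lemma mdeg_dnDU i l : (mdeg (dn i + U_(l))%MM < d)%N.
Proof. by rewrite mdeg_dnDU_eq. Qed.

Lemma sum_up (F : 'X_{1..3} -> int) (v : 'X_{1..3}) :
    (mdeg v).+1 = d ->
  \sum_j (bmnm (up j) == v)%:R * F (up j) = (~~ in_ideal I v)%:R * F v.
Proof.
move=> dv; have lt_vd : (mdeg v < d)%N by rewrite dv.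
rewrite (big_revlex_enum_cast _ bal (fun u => (bmnm u == v)%:R * F u)).
by rewrite (sum_label_eq _ lt_vd) mem_ups /= dv eqxx.
Qed.

Lemma sum_en (F : 'X_{1..3} -> int) i :
  \sum_k (bmnm (en k) == dn i + U_(iz))%MM%:R * F (en k) =
    (in_ideal I (dn i + U_(iz))%MM)%:R * F (dn i + U_(iz))%MM.
Proof.
rewrite (big_revlex_enum_cast _ balAE
  (fun u => (bmnm u == dn i + U_(iz))%MM%:R * F u)).
rewrite (sum_label_eq _ (mdeg_dnDU i _)) mem_path_ends_zS.
by have := dn_mem i; rewrite mem_downs => /andP[-> ->].
Qed.

Lemma st_neq_dn_z a i : (dn i + U_(iz))%MM != st a.
Proof.
apply: contraTneq (st_mem a); rewrite mem_path_starts => <-.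
by rewrite mnmDUz !andbF.
Qed.

(* Cramer's rule: the paths, with the sign of the exponent of z, give the last
   block of columns of the inverse of the bordered matrix. *)
Lemma det_step_mx_bordered w :
    (forall n l, n \in D -> l != iz -> w (bmnm n) l ->
       ~~ in_ideal I (n + U_(l))%MM) ->
  \det (step_mx w) = \det (bordered_mx w) * (ends_sign * \det (path_mx w)).
Proof.
move=> wI.
pose sp a (v : 'X_{1..3}) : int := (-1) ^+ (v iz) * paths w a v.
pose X2 : 'M_(#|D|, #|A|) := \matrix_(j, i) sp (st i) (up j).
pose X4 : 'M_#|A| := \matrix_(j, i) sp (st i) (en j).
have -> : ends_sign * \det (path_mx w) = \det X4.
  have -> : X4 = diag_mx (\row_j (-1) ^+ bmnm (en j) iz) *m (path_mx w)^T.
    by apply/matrixP => i j; rewrite mul_diag_mx !mxE.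
  rewrite det_mulmx det_tr det_diag; congr (_ * _).
  rewrite /ends_sign.
  rewrite -(big_revlex_enum_cast _ balAE (fun u => (-1) ^+ bmnm u iz)).
  by apply: eq_bigr => j _; rewrite mxE.
have -> : \det X4 = \det (block_mx 1%:M X2 0 X4).
  by rewrite det_ublock det1 mul1r.
(* The product of the two block matrices will be lower block triangular, with [step_mx w] and the
   identity on its diagonal. *)
rewrite -det_mulmx /bordered_mx mulmx_block !mulmx0 !mul0mx !mulmx1 !addr0.
have -> : step_mx w *m X2 + ends_mx *m X4 = 0.
  apply/matrixP => i a; rewrite !mxE.
  under eq_bigr do rewrite !mxE mulrDl mulr_suml.
  under [X in _ + X]eq_bigr do rewrite !mxE.
  rewrite big_split /= exchange_big /= sum_up ?mdeg_dnDU_eq // sum_en.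
  rewrite addrAC -mulrDl -natrD.
  (* zn is a column in U if it lies outside I and a column in E otherwise, so exactly one of the two
     sums contains its term. *)
  have -> (b : bool) : (~~ b + b = 1)%N by case: b.
  (* The recursion of [paths] at zn cancels the terms at xn and yn, whose exponent of z is one less
     and whose sign is therefore opposite. *)
  rewrite mul1r {1}/sp paths_zS (negPf (st_neq_dn_z a i)).
  rewrite add0r mnmDUz exprS mulN1r mulNr mulr_sumr -sumrN -big_split /=.
  apply: big1 => l l_z.
  under eq_bigr do rewrite -mulrA.
  rewrite -mulr_sumr sum_up ?mdeg_dnDU_eq // /sp mnmDUNz //.
  (* An allowed step starts outside I, hence at a column in U. *)
  case: (boolP (w _ l)) => [/(wI _ _ (dn_mem i) l_z) ->|_].
    by rewrite !mul1r addNr.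
  by rewrite !mul0r mulr0 oppr0 addr0.
have -> : starts_mx *m X2 = 1%:M.
  apply/matrixP => i a; rewrite !mxE.
  under eq_bigr do rewrite !mxE.
  have := st_mem i; rewrite mem_path_starts => /and3P[/eqP di Ii /eqP zi].
  rewrite sum_up // Ii /sp zi paths_z0 // !mul1r.
  by rewrite -[bmnm _ == _]/(st i == st a) (inj_eq (@tnth_revlex_enum_inj _ _)).
by rewrite det_lblock det1 mulr1.
Qed.


(** Without steps, the row of zn or of a start has its only 1 at the column with the same label:
    this is a permutation matrix. *)
Lemma bordered_mx0_mul_tr :
  bordered_mx (fun _ _ => false) *m (bordered_mx (fun _ _ => false))^T = 1%:M.
Proof.
set w0 := fun _ _ => false.
have stepE i j : step_mx w0 i j = (bmnm (up j) == dn i + U_(iz))%MM%:R.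
  by rewrite mxE big1 ?addr0 // => l _; rewrite mul0r.
have stst : step_mx w0 *m starts_mx^T = 0.
  apply/matrixP => i a; rewrite !mxE.
  under eq_bigr => j _ do rewrite stepE !mxE.
  rewrite (sum_up (fun v => (v == st a)%:R)) ?mdeg_dnDU_eq //.
  by rewrite (negPf (st_neq_dn_z _ _)) mulr0.
rewrite /bordered_mx tr_block_mx mulmx_block trmx0 !mulmx0 !mul0mx !addr0.
rewrite stst -[starts_mx *m _]trmxK trmx_mul trmxK stst trmx0.
have -> : step_mx w0 *m (step_mx w0)^T + ends_mx *m ends_mx^T = 1%:M.
  apply/matrixP => i i'; rewrite !mxE.
  under eq_bigr => j _ do rewrite [X in _ * X]mxE !stepE.
  under [X in _ + X]eq_bigr do rewrite !mxE.
  rewrite (sum_up (fun v => (v == dn i' + U_(iz))%MM%:R)) ?mdeg_dnDU_eq //.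
  rewrite (sum_en (fun v => (v == dn i' + U_(iz))%MM%:R)) -mulrDl -natrD.
  rewrite eqm_add2r -[bmnm _ == _]/(dn i == dn i').
  rewrite (inj_eq (@tnth_revlex_enum_inj _ _)).
  by case: in_ideal; rewrite mul1r.
have -> : starts_mx *m starts_mx^T = 1%:M.
  apply/matrixP => a a'; rewrite !mxE.
  under eq_bigr do rewrite !mxE.
  have := st_mem a; rewrite mem_path_starts => /and3P[/eqP da Ia _].
  rewrite (sum_up (fun v => (v == st a')%:R)) // Ia mul1r.
  rewrite -[bmnm _ == _]/(st a == st a').
  by rewrite (inj_eq (@tnth_revlex_enum_inj _ _)).
by rewrite -scalar_mx_block.
Qed.

Lemma det_bordered_mx0 : `|\det (bordered_mx (fun _ _ => false))| = 1 :> int.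
Proof.
have := congr1 determinant bordered_mx0_mul_tr.
rewrite det_mulmx det_tr det1 -expr2 => /eqP; rewrite sqrf_eq1.
by case/pred2P=> ->; rewrite ?normrN normr1.
Qed.

(** Grade each index by its exponent of z, row n counting as zn. Without steps the nonzero entries
    preserve the grade; a step adds an entry whose column has a grade lower by 1. *)
Lemma det_bordered_mx w :
  \det (bordered_mx w) = \det (bordered_mx (fun _ _ => false)).
Proof.
pose f (j : 'I_(#|D| + #|A|)) : nat :=
  match split j with inl j => bmnm (up j) iz | inr k => bmnm (en k) iz end.
pose g (i : 'I_(#|D| + #|A|)) : nat :=
  match split i with inl i => (bmnm (dn i) iz).+1 | inr _ => 0%N end.
have splitl i : split (lshift #|A| i) = inl i by exact: (unsplitK (inl _)).
have splitr i : split (rshift #|D| i) = inr i by exact: (unsplitK (inr _)).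
(* [det_graded] wants the smaller grade on the rows, whence the transposes. *)
rewrite -det_tr -[RHS]det_tr; apply: (@det_graded _ _ _ _ f g).
- by rewrite det_tr -normr_eq0 det_bordered_mx0.
- move=> j i; rewrite mxE /f /g; case: (split_ordP i) => {}i ->;
    case: (split_ordP j) => {}j ->.
  + rewrite block_mxEul mxE big1 ?addr0 => [|l _]; last by rewrite mul0r.
    by case: (bmnm (up j) =P _) => [-> _|_]; rewrite ?mnmDUz ?eqxx.
  + rewrite block_mxEur mxE.
    by case: (bmnm (en j) =P _) => [-> _|_]; rewrite ?mnmDUz ?eqxx.
  + rewrite block_mxEdl mxE.
    case: (bmnm (up j) =P _) => [-> _|_]; last by rewrite eqxx.
    by have := st_mem i; rewrite mem_path_starts => /and3P[_ _ /eqP].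
  + by rewrite block_mxEdr mxE eqxx.
move=> j i; rewrite ![_^T _ _]mxE /f /g; case: (split_ordP i) => {}i ->;
  case: (split_ordP j) => {}j ->;
  rewrite ?block_mxEur ?block_mxEdl ?block_mxEdr ?eqxx //.
rewrite !block_mxEul !mxE (inj_eq (addrI _)) => neq_w.
case: (boolP [exists l, (l != iz) && (bmnm (up j) == dn i + U_(l))%MM]).
  by case/existsP => l /andP[l_z /eqP->]; rewrite mnmDUNz.
move/existsPn => no_l; case/negP: neq_w; apply/eqP.
apply: eq_bigr => l l_z; have := no_l l.
by rewrite l_z /= => /negPf ->; rewrite !mulr0.
Qed.

Lemma norm_det_step_mx w :
    (forall n l, n \in D -> l != iz -> w (bmnm n) l ->
       ~~ in_ideal I (n + U_(l))%MM) ->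
  `|\det (step_mx w)| = `|\det (path_mx w)|.
Proof.
move=> wI; rewrite det_step_mx_bordered // det_bordered_mx !normrM.
rewrite det_bordered_mx0 mul1r /ends_sign normr_prod big1 ?mul1r // => u _.
by rewrite normrX normrN normr1 expr1n.
Qed.

(** * From Z(T) to the matrix of all lattice paths *)

Lemma step_mxE w i j l : bmnm (up j) = (dn i + U_(l))%MM ->
  step_mx w i j = ((l == iz) || w (bmnm (dn i)) l)%:R.
Proof.
move=> up_j; rewrite mxE up_j mnmDU_eq; case: (eqVneq l iz) => [->|l_z] /=.
  rewrite big1 ?addr0 // => l' l'_z.
  by rewrite mnmDU_eq eq_sym (negPf l'_z) mulr0.
rewrite add0r (bigD1 l) //= mnmDU_eq eqxx mulr1.
rewrite big1 ?addr0 // => l' /andP[_ l'_l].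
by rewrite mnmDU_eq eq_sym (negPf l'_l) mulr0.
Qed.

Lemma step_mx_nadjacent w i j : ~~ adjacent (dn i) (up j) -> step_mx w i j = 0.
Proof.
move=> /existsPn nadj; rewrite mxE (negPf (nadj iz)) add0r big1 // => l _.
by rewrite (negPf (nadj l)) mulr0.
Qed.

Definition region_step (n : 'X_{1..3}) (l : 'I_3) : bool :=
  ~~ in_ideal I (n + U_(l))%MM.

(** The columns are labels in U, hence outside I, so [region_step] allows every adjacency. *)
Lemma step_mx_region : step_mx region_step = castmx (erefl, esym bal) (Zmx I d).
Proof.
apply/matrixP => i j; rewrite castmxE esymK /= cast_ord_id [RHS]mxE.
rewrite -/(dn i) -/(up j).
case: (boolP (adjacent _ _)) => [adj|nadj]; last first.
  exact: step_mx_nadjacent.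
have /existsP[l /eqP up_j] := adj.
rewrite (step_mxE _ up_j) /region_step -up_j.
by have := up_mem j; rewrite mem_ups => /andP[_ ->]; rewrite orbT.
Qed.

Lemma paths_any_graded a v :
  paths any_step a v != (v == a)%:R -> (a iz < v iz)%N.
Proof.
move: v; apply: (@mnm_z_ind (fun v => _ -> _)) => [v v_z|n IHn].
  by rewrite paths_z0 ?eqxx.
rewrite paths_zS mnmDUz ltnS; apply: contraR; rewrite -ltnNge => lt_n_a.
rewrite big1 ?addr0 // => l l_z; rewrite mul1r.
have ltz : ((n + U_(l))%MM iz < a iz)%N by rewrite mnmDUNz.
have /negPf neq_a : (n + U_(l))%MM != a.
  by apply: contraTneq ltz => ->; rewrite ltnn.
apply/eqP; apply: contraTT ltz => nz; rewrite -leqNgt ltnW //.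
by apply: IHn => //; rewrite neq_a.
Qed.

(** A nonempty path strictly raises the exponent of z, so this matrix is unitriangular for that
    grading. *)
Lemma det_path_ends_mx :
  \det (\matrix_(i, j) paths any_step (en i) (en j)) = 1.
Proof.
rewrite -(det1 _ #|A|).
pose ez i := bmnm (en i) iz; apply: (@det_graded _ _ _ _ ez ez).
- by rewrite det1 oner_neq0.
- by move=> i j; rewrite mxE; case: (i =P j) => [->|_]; rewrite ?eqxx.
move=> i j; rewrite !mxE => ne; apply: paths_any_graded; move: ne.
rewrite -[bmnm _ == _]/(en j == en i) (inj_eq (@tnth_revlex_enum_inj _ _)).
by rewrite (inj_eq (@cast_ord_inj _ _ _)) [j == i]eq_sym.
Qed.

(* A path that starts outside I and ends in I is cut at its first point in I,
   which is a path end. *)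
Lemma paths_first_entrance i v : (mdeg v).+1 = d ->
  paths any_step (st i) v =
    (~~ in_ideal I v)%:R * paths region_step (st i) v +
    \sum_k paths region_step (st i) (en k) * paths any_step (en k) v.
Proof.
have := st_mem i; rewrite mem_path_starts => /and3P[_ Ist st_z].
move: v; apply: (@mnm_z_ind (fun v => _ -> _)) => [v v_z _|n IHn].
  rewrite !(paths_z0 _ _ v_z) big1 ?addr0 => [|k _].
    by case: eqP => [->|]; rewrite ?Ist ?mulr0.
  rewrite (paths_z0 _ _ v_z) (_ : v == en k = false) ?mulr0 //.
  apply: contraTF (en_mem k) => /eqP v_en.
  by rewrite inE -v_en v_z andbF.
rewrite mdegDU => dn_d.
have lt_nd : (mdeg (n + U_(iz))%MM < d)%N by rewrite mdegDU dn_d.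
have /negPf neq_st : (n + U_(iz))%MM != st i.
  by apply: contraTneq st_z => <-; rewrite mnmDUz.
rewrite !paths_zS neq_st !add0r.
under [X in _ = _ + X]eq_bigr do rewrite paths_zS mulrDr mulr_sumr.
rewrite big_split exchange_big /=.
under eq_bigr => l l_z do
  rewrite mul1r (IHn l l_z) ?mdegDU // -/(region_step n l).
rewrite big_split /= addrA; congr (_ + _); last first.
  by apply: eq_bigr => l _; apply: eq_bigr => k _; rewrite mul1r.
set S := \sum_(l | _) _.
(* The contribution of the empty second piece, present when zn is itself a path end. *)
have -> : \sum_k paths region_step (st i) (en k) *
             (((n + U_(iz))%MM == en k)%:R : int) =
    (~~ in_ideal I n && in_ideal I (n + U_(iz))%MM)%:R * S.
  under eq_bigr => k _ do rewrite mulrC eq_sym.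
  rewrite (big_revlex_enum_cast _ balAE
    (fun u => (bmnm u == n + U_(iz))%MM%:R * paths region_step (st i) u)).
  rewrite (sum_label_eq _ lt_nd) mem_path_ends_zS dn_d eqxx /=.
  by rewrite paths_zS neq_st add0r.
(* If n is in I, so are xn and yn, and [S] vanishes. Otherwise zn is either outside I or a path end,
   and [S] is counted once. *)
rewrite -mulrDl -natrD; case: (boolP (in_ideal I n)) => [In|nIn] /=.
  rewrite {2}/S big1 ?mulr0 => [|l _]; last first.
    by rewrite /region_step in_idealMX ?mul0r.
  by rewrite /S big1 // => l _; rewrite /region_step in_idealMX ?mul0r.
by case: in_ideal; rewrite mul1r.
Qed.

Lemma det_path_mx_any : \det (path_mx any_step) = \det (path_mx region_step).
Proof.
rewrite -[RHS]mulr1 -det_path_ends_mx -det_mulmx; congr determinant.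
apply/matrixP => i j; rewrite !mxE.
(* The end lies in I, so only the sum over first entrances remains, which is a matrix product. *)
have := en_mem j; rewrite inE => /and4P[/eqP d_j _ _ I_j].
rewrite paths_first_entrance // I_j mul0r add0r.
by apply: eq_bigr => k _; rewrite !mxE.
Qed.

(** * Signs of a lozenge tiling *)

Section Tiling.
Variable tau : {set {set label d}}.
Hypothesis tau_tiling : lozenge_tiling I tau.

Lemma tiling_block_eq (L L' : {set label d}) (t : label d) :
  L \in tau -> L' \in tau -> t \in L -> t \in L' -> L = L'.
Proof.
have /andP[/and3P[_ trivT _] _] := tau_tiling.
move=> LT L'T tL tL'.
by rewrite -(def_pblock trivT LT tL) (def_pblock trivT L'T tL').
Qed.

Lemma tiling_block_region (L : {set label d}) (t : label d) :
  L \in tau -> t \in L -> t \in region I d.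
Proof.
have /andP[/and3P[/eqP<- _ _] _] := tau_tiling.
by move=> LT tL; apply/bigcupP; exists L.
Qed.

Lemma downs_neq_ups (n u : label d) : n \in D -> u \in U -> n != u.
Proof.
rewrite mem_downs mem_ups => /andP[/eqP dn_d _] /andP[/eqP du_d _].
apply/eqP => n_u; have : (mdeg n).+2 = (mdeg n).+1 by rewrite dn_d n_u du_d.
by move/esym/n_Sn.
Qed.

Lemma tiling_ups_inj (n u u' : label d) : n \in D -> u \in U ->
  [set n; u] \in tau -> [set n; u'] \in tau -> u = u'.
Proof.
move=> nD uU nuT nu'T; have := set22 n u.
rewrite (tiling_block_eq nuT nu'T (set21 n u) (set21 n u')) !inE.
by rewrite eq_sym (negPf (downs_neq_ups nD uU)) => /eqP.
Qed.

Lemma tiling_downs_inj (n n' u : label d) : n \in D -> u \in U ->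
  [set n; u] \in tau -> [set n'; u] \in tau -> n = n'.
Proof.
move=> nD uU nuT nu'T; have := set21 n u.
rewrite (tiling_block_eq nuT nu'T (set22 n u) (set22 n' u)) !inE.
by rewrite (negPf (downs_neq_ups nD uU)) orbF => /eqP.
Qed.

Lemma tiling_ups (n u : label d) l : n \in D -> bmnm u = (n + U_(l))%MM ->
  [set n; u] \in tau -> u \in U.
Proof.
rewrite mem_downs => /andP[dn_d _] u_n /tiling_block_region/(_ (set22 n u)).
rewrite inE mem_ups u_n => /andP[_ ->].
by rewrite mdegDU dn_d.
Qed.

Lemma tiling_downsP (n : label d) : n \in D ->
  exists l (u : label d),
    [/\ u \in U, bmnm u = (n + U_(l))%MM & [set n; u] \in tau].
Proof.
move=> nD; have nR : n \in region I d by move: nD; rewrite inE => /andP[].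
have /andP[/and3P[/eqP covT _ _] /forallP lozT] := tau_tiling.
move: nR; rewrite -covT => /bigcupP[L LT nL].
have /existsP[n' /existsP[u]] := implyP (lozT L) LT.
case/and4P=> dn' du adj /eqP L_nu.
have uU : u \in U.
  by rewrite inE du andbT (tiling_block_region LT) // L_nu set22.
have /existsP[l /eqP u_n'] := adj.
move: nL; rewrite L_nu !inE (negPf (downs_neq_ups nD uU)) orbF => /eqP n_n'.
by exists l, u; rewrite n_n' -L_nu.
Qed.

Lemma upP u : u \in U -> exists j, u = up j.
Proof.
case/revlex_enumP => k ->; exists (cast_ord (esym bal) k).
by rewrite /up cast_ordKV.
Qed.

(** Phrased on bare monomials, with both labels quantified, so that it can be used as a [w]. *)
Definition in_tiling (n : 'X_{1..3}) (l : 'I_3) : bool :=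
  [exists a in D, exists b : label d,
     [&& bmnm a == n, bmnm b == (n + U_(l))%MM & [set a; b] \in tau]].

Lemma in_tilingE (n u : label d) l : n \in D -> bmnm u = (n + U_(l))%MM ->
  in_tiling n l = ([set n; u] \in tau).
Proof.
move=> nD u_n; apply/existsP/idP => [[a /andP[_ /existsP[b]]]|nuT].
  case/and3P => /eqP/val_inj -> /eqP b_n.
  by have -> : b = u by apply: val_inj; rewrite /= b_n u_n.
by exists n; rewrite nD; apply/existsP; exists u; rewrite u_n !eqxx.
Qed.

Lemma in_tiling_notin_ideal (n : label d) l :
  n \in D -> l != iz -> in_tiling n l -> ~~ in_ideal I (n + U_(l))%MM.
Proof.
move=> _ _ /existsP[a /andP[aD /existsP[b /and3P[/eqP a_n /eqP b_n abT]]]].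
rewrite -b_n; have : b \in U by apply: (tiling_ups aD _ abT); rewrite b_n a_n.
by rewrite mem_ups => /andP[].
Qed.

Lemma tiling_perm :
  exists s : 'S_#|D|, forall i j, ([set dn i; up j] \in tau) = (j == s i).
Proof.
have exT i : exists j, [set dn i; up j] \in tau.
  by have [l [u [/upP[j ->] _ iuT]]] := tiling_downsP (dn_mem i); exists j.
pose f i := xchoose (exT i).
have fT i : [set dn i; up (f i)] \in tau := xchooseP (exT i).
have f_inj : injective f.
  move=> i i' eq_f; have fiT := fT i; have := fT i'; rewrite -eq_f.
  move=> /(tiling_downs_inj (dn_mem _) (up_mem _))/(_ fiT).
  by move/tnth_revlex_enum_inj.
exists (perm f_inj) => i j; rewrite permE; apply/idP/eqP => [ijT|-> //].
have := tiling_ups_inj (dn_mem i) (up_mem j) ijT (fT i).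
by move/tnth_revlex_enum_inj/cast_ord_inj.
Qed.

(* Adding to the matching the entries that join n and zn creates no other
   perfect matching, since the added entries have too large an exponent of z. *)
Lemma det_step_mx_tiling : \det (step_mx in_tiling) = msgn bal tau.
Proof.
have [s sT] := tiling_perm.
pose R i j := [set dn i; tnth (revlex_enum U) j] \in tau.
have det_R := @det_perm_of_rel _ _ bal R s sT; rewrite /msgn -det_R.
(* Each row gets the exponent of z of its matched column. An added entry lies at zn in a row matched
   with xn or yn, whose exponent is one less. *)
pose uz j := bmnm (up j) iz.
apply: (@det_graded _ _ _ _ (fun i => uz (s i)) uz).
- by rewrite det_R signr_eq0.
- by move=> i j; rewrite mxE /R sT; case: (eqVneq j (s i)) => [->|].
move=> i j; rewrite [X in _ != X]mxE /R sT.
case: (boolP (adjacent (dn i) (up j))) => [adj|nadj]; last first.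
  rewrite step_mx_nadjacent //; case: (eqVneq j (s i)) => // js _.
  have [l [u [uU u_n iuT]]] := tiling_downsP (dn_mem i).
  have [k u_k] := upP uU; move: iuT nadj; rewrite u_k sT js => /eqP <-.
  by rewrite -u_k => /existsPn/(_ l); rewrite u_n eqxx.
have /existsP[l /eqP up_j] := adj.
rewrite (step_mxE _ up_j) (in_tilingE (dn_mem i) up_j) sT.
case: (eqVneq l iz) up_j => [->|l_z] up_j; last by rewrite eqxx.
case: (eqVneq j (s i)) => // j_s _.
have [l' [u [uU u_n iuT]]] := tiling_downsP (dn_mem i).
have [k u_k] := upP uU; move: iuT; rewrite u_k sT => /eqP k_s.
rewrite -k_s /uz up_j -u_k u_n mnmDUz mnmDUNz //.
apply: contraNneq j_s => l'_z; apply/eqP; rewrite -k_s.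
apply: (@cast_ord_inj _ _ bal); apply: (@tnth_revlex_enum_inj _ U).
by apply: val_inj; rewrite -/(up j) -/(up k) /= up_j -u_k u_n l'_z.
Qed.

Lemma tiling_stepP (u v : label d) :
  reflect (exists2 n : label d, n \in D /\ bmnm v = (n + U_(iz))%MM &
     exists2 l, l != iz & bmnm u = (n + U_(l))%MM /\ [set n; u] \in tau)
    (tiling_step I tau u v).
Proof.
apply: (iffP existsP) => [[n /andP[nD /existsP[l]]]|[n [nD v_n]]].
  by case/and4P=> l_z /eqP u_n nuT /eqP v_n; exists n => //; exists l.
case=> l l_z [u_n nuT].
exists n; rewrite nD; apply/existsP; exists l.
by rewrite l_z u_n v_n nuT !eqxx.
Qed.

(** A point zn determines n, and n lies in a single lozenge, so each point has at most one
    predecessor and the count is 0 or 1. *)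
Lemma paths_in_tiling i (v : label d) : (mdeg v).+1 = d ->
  paths in_tiling (st i) v = (connect (tiling_step I tau) (st i) v)%:R.
Proof.
have := st_mem i; rewrite mem_path_starts => /and3P[_ Ist /eqP st_z].
have [m] := ubnP (bmnm v iz); elim: m v => // m IHm v lt_vm deg_v.
have [v_z|v_gt0] := posnP (bmnm v iz).
  rewrite paths_z0 //; congr ((nat_of_bool _)%:R); apply/eqP/idP => [v_st|].
    by rewrite (val_inj v_st) connect0.
  case/connect_last => [-> //|[u _ /tiling_stepP[n [_ v_n] _]]].
  by move: v_z; rewrite v_n mnmDUz.
have v_neq : st i != v by apply: contraTneq v_gt0 => <-; rewrite st_z.
have v_n := mnm_subUzK v_gt0; set n := (v - U_(iz))%MM in v_n.
rewrite -v_n paths_zS v_n eq_sym -[bmnm _ == _]/(st i == v) (negPf v_neq) add0r.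
case: (boolP (connect _ _ _)) => [|nconn].
  case/connect_last => [eq_v|[u conn_u]]; first by rewrite eq_v eqxx in v_neq.
  case/tiling_stepP => a [aD v_a] [l l_z [u_a auT]].
  have a_n : bmnm a = n by rewrite /n v_a addmK.
  rewrite (bigD1 l) //= -a_n (in_tilingE aD u_a) auT mul1r.
  rewrite big1 => [|l' /andP[l'_z l'_l]].
    rewrite -u_a IHm ?conn_u ?addr0 //.
      by move: lt_vm; rewrite u_a v_a mnmDUz (mnmDUNz _ l_z).
    by move: deg_v; rewrite u_a v_a !mdegDU.
  case: (boolP (in_tiling _ _)); rewrite ?mul0r //.
  case/existsP => a' /andP[_ /existsP[b /and3P[/eqP/val_inj -> /eqP b_a abT]]].
  have uU := tiling_ups aD u_a auT.
  have u_b := tiling_ups_inj aD uU auT abT.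
  by move: l'_l; rewrite -(mnmDU_eq a) -b_a -u_a u_b eqxx.
rewrite big1 // => l l_z; case: (boolP (in_tiling _ _)); rewrite ?mul0r //.
case/existsP => a /andP[aD /existsP[b /and3P[/eqP a_n /eqP b_n abT]]].
rewrite -b_n IHm ?mul1r.
- case: (boolP (connect _ _ _)) => // conn_b; case/negP: nconn.
  apply: connect_trans conn_b (connect1 _); apply/tiling_stepP.
  by exists a; [rewrite a_n v_n | exists l; rewrite ?a_n].
- by move: lt_vm; rewrite b_n -v_n mnmDUz (mnmDUNz _ l_z).
by move: deg_v; rewrite b_n -v_n !mdegDU.
Qed.

(** The lozenge that covers [u] is unique; it fixes n and hence zn. This is why the paths do not
    merge or branch. *)
Lemma tiling_step_functional (u v v' : label d) :
  tiling_step I tau u v -> tiling_step I tau u v' -> v = v'.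
Proof.
case/tiling_stepP => n [nD v_n] [l _ [u_n nuT]].
case/tiling_stepP => n' [nD' v'_n'] [l' _ [u_n' nuT']].
apply: val_inj; rewrite /= v_n v'_n'.
by rewrite (tiling_downs_inj nD (tiling_ups nD u_n nuT) nuT nuT').
Qed.

Lemma tiling_step_en k v : ~~ tiling_step I tau (en k) v.
Proof.
apply/negP => /tiling_stepP[n [nD _] [l _ [e_n neT]]].
have := tiling_ups nD e_n neT; rewrite mem_ups.
by have := en_mem k; rewrite inE => /and4P[_ _ _ ->]; rewrite andbF.
Qed.

(** Each start reaches at most one end, since steps are deterministic and ends have no successor.
    That this is a bijection follows from a nonzero determinant. *)
Lemma det_path_mx_tiling : \det (path_mx in_tiling) = lpsgn balAE tau.
Proof.
pose R i j := connect (tiling_step I tau) (st i) (tnth (revlex_enum E) j).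
have pathE : path_mx in_tiling = \matrix_(i, j) (R i (cast_ord balAE j))%:R.
  apply/matrixP => i j; rewrite !mxE paths_in_tiling //.
  by have := en_mem j; rewrite inE => /and4P[/eqP].
have [||s sR] := @functional_det_neq0 _ (fun i j => R i (cast_ord balAE j)).
- move=> i j k Rij Rik.
  apply: (@cast_ord_inj _ _ balAE); apply: (@tnth_revlex_enum_inj _ E).
  apply: (connect_functional tiling_step_functional Rij Rik) => v.
    exact: (tiling_step_en j).
  exact: (tiling_step_en k).
(* Up to sign this determinant is that of [step_mx in_tiling], which is [msgn]. *)
- rewrite -pathE -normr_eq0 -(norm_det_step_mx in_tiling_notin_ideal).
  by rewrite det_step_mx_tiling normr_eq0 signr_eq0.
by rewrite pathE (det_perm_of_rel sR).
Qed.

(** The factor before [lpsgn] depends on the region alone, so it is common to all tilings. *)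
Lemma msgn_lpsgn :
  msgn bal tau =
    \det (bordered_mx (fun _ _ => false)) * ends_sign * lpsgn balAE tau.
Proof.
rewrite -det_step_mx_tiling (det_step_mx_bordered in_tiling_notin_ideal).
by rewrite det_bordered_mx det_path_mx_tiling mulrA.
Qed.

End Tiling.

(** * Comparison of the determinants and of the signs *)

Lemma norm_det_Zmx_Nmx :
  `|\det (castmx (erefl, esym bal) (Zmx I d))| =
  `|\det (castmx (erefl, esym balAE) (Nmx I d))|.
Proof.
rewrite -step_mx_region norm_det_step_mx => [|//].
rewrite -det_path_mx_any; congr (`| \det _ |).
apply/matrixP => i j; rewrite castmxE esymK /= cast_ord_id !mxE.
have := st_mem i; rewrite mem_path_starts => /and3P[/eqP deg_i _ /eqP st_z].
have := en_mem j; rewrite inE => /and4P[/eqP deg_j _ _ _].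
by rewrite -num_lattice_paths_paths.
Qed.

End Region.

(** Since [l] and [l'] square to 1, both products equal [c]. *)
Lemma proportional_signs (R : idomainType) (c l l' m m' : R) :
    c != 0 -> m = c * l -> m' = c * l' -> l * l = 1 -> l' * l' = 1 ->
  (m = m' <-> l = l') /\ m * l = m' * l'.
Proof.
move=> c_neq0 -> -> l_sq l'_sq; rewrite -!mulrA l_sq l'_sq.
by split=> //; split=> [/(mulfI c_neq0)|->].
Qed.

Theorem theorem5p17 (K : fieldType) (I : set {mpoly K[3]})
    (hI : monomial_ideal I) (d : nat) (hd : (1 <= d)%N)
    (bal : balanced I d) :
  (forall tau tau' : {set {set label d}},
     lozenge_tiling I tau -> lozenge_tiling I tau' ->
     (msgn bal tau = msgn bal tau' <->
      lpsgn (card_path_ends hI bal) tau = lpsgn (card_path_ends hI bal) tau') /\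
     msgn bal tau * lpsgn (card_path_ends hI bal) tau =
     msgn bal tau' * lpsgn (card_path_ends hI bal) tau') /\
  `|\det (castmx (erefl, esym bal) (Zmx I d))| =
  `|\det (castmx (erefl, esym (card_path_ends hI bal)) (Nmx I d))|.
Proof.
split; last exact: norm_det_Zmx_Nmx.
set e := card_path_ends hI bal => tau tau' tauT tauT'.
have [c msgnE] : exists c, forall t, lozenge_tiling I t ->
    msgn bal t = c * lpsgn e t.
  by eexists => t; exact: msgn_lpsgn.
(* A zero constant would make [msgn], a power of -1, vanish. *)
have c_neq0 : c != 0.
  by apply: contra_eq_neq (msgnE _ tauT) => ->; rewrite mul0r signr_eq0.
have lpsgn_sq t : lpsgn e t * lpsgn e t = 1 by rewrite -expr2 sqrr_sign.
exact: (proportional_signs c_neq0 (msgnE _ tauT) (msgnE _ tauT')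
  (lpsgn_sq tau) (lpsgn_sq tau')).
Qed.
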